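(* Let $\lambda\in\mathbb{R}$ and let $\gamma:[a,b]\to\mathbb{H}^2_+$ be a smooth regular curve along which $d_{hor}+\lambda\neq0$. Then $\gamma$ is a hyperbolic horo-catenary (with parameter $\lambda$) if and only if its curvature $\kappa_h$ in $\mathbb{H}^2$ satisfies $$\kappa_h=\frac{g(\mathbf{n},W)}{d_{hor}+\lambda},$$ where $\mathbf{n}$ is the unit normal vector of $\gamma$ and $W(x,y)=y\,\partial_x-x\,\partial_y$.
   Context: $\mathbb{H}^2$ is the upper half-plane $\{(x,y)\in\mathbb{R}^2:y>0\}$ with the metric $g=\frac{dx^2+dy^2}{y^2}$, and $\mathbb{H}^2_+=\{(x,y)\in\mathbb{H}^2:x>0\}$. The horocycle distance of $(x,y)\in\mathbb{H}^2_+$ to the geodesic $L=\{(0,y):y>0\}$ is $d_{hor}=x/y$. The potential energy of $\gamma=(u,v)$ is $$\mathcal{E}^{hor}_H[\gamma]=\int_a^b\left(\frac{u}{v}+\lambda\right)\frac{\sqrt{u'^2+v'^2}}{v}\,dt,$$ where $\lambda\in\mathbb{R}$ is a fixed constant (a Lagrange multiplier). A hyperbolic horo-catenary is a critical point of $\mathcal{E}^{hor}_H$, i.e. a curve at which the first variation vanishes for all smooth variations in $\mathbb{H}^2_+$ with fixed endpoints (equivalently, $(u,v)$ satisfies both Euler–Lagrange equations of the integrand). With $m=u'^2+v'^2$, the unit normal is $\mathbf{n}=v\frac{(-v',u')}{\sqrt m}$, and $\kappa_h$ is the geodesic curvature with respect to $\mathbf{n}$; explicitly $\kappa_h=v\,\frac{u'v''-u''v'}{m^{3/2}}+\frac{u'}{\sqrt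 m}$. *)

(* Defs.v *)
From Stdlib Require Import Reals.
From Coquelicot Require Import Coquelicot.

Open Scope R_scope.

(** Points and tangent vectors of the half-plane are pairs in coordinates. *)

Definition in_Hplus (p : R * R) : Prop := 0 < fst p /\ 0 < snd p.

Definition hyp_metric (p X Y : R * R) : R :=
  (fst X * fst Y + snd X * snd Y) / (snd p) ^ 2.

Definition d_hor (p : R * R) : R := fst p / snd p.

Definition W (p : R * R) : R * R := (snd p, - fst p).

(** Smoothness on the closed interval [[a,b]] is smoothness on an open
    neighbourhood of it. Curves are therefore total functions on [R] of which
    only the values near [[a,b]] matter, and [Derive] at the endpoints is the
    genuine (one-sided) derivative of the restriction. *)
Definition smooth_on (a b : R) (f : R -> R) : Prop :=
  exists d : R, 0 < d /\
    forall t : R, a - d < t < b + d -> forall n : nat, ex_derive_n f n t.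

(** [ex_diff_n F n s t]: the iterated partial derivatives of [F] of order at
    most [n], in every order of differentiation, exist and are jointly
    continuous at [(s,t)]. *)
Definition smooth2_on (e a b : R) (F : R -> R -> R) : Prop :=
  exists d : R, 0 < d /\
    forall s t : R, - e < s < e -> a - d < t < b + d ->
      forall n : nat, ex_diff_n F n s t.

Definition smooth_regular_curve (a b : R) (u v : R -> R) : Prop :=
  smooth_on a b u /\ smooth_on a b v /\
  (forall t : R, a <= t <= b -> in_Hplus (u t, v t)) /\
  (forall t : R, a <= t <= b -> (Derive u t, Derive v t) <> (0, 0)).

Definition speed2 (u v : R -> R) (t : R) : R :=
  (Derive u t) ^ 2 + (Derive v t) ^ 2.

Definition energy_hor (lam a b : R) (u v : R -> R) : R :=
  RInt (fun t => (u t / v t + lam) * (sqrt (speed2 u v t) / v t)) a b.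

(** [(U s, V s)], [- e < s < e], is a smooth variation of [(u, v)] through
    curves of the quarter plane with the same endpoints. *)
Definition variation (a b : R) (u v : R -> R) (e : R) (U V : R -> R -> R)
    : Prop :=
  0 < e /\
  smooth2_on e a b U /\ smooth2_on e a b V /\
  (forall t : R, a <= t <= b -> U 0 t = u t /\ V 0 t = v t) /\
  (forall s : R, - e < s < e ->
     U s a = u a /\ V s a = v a /\ U s b = u b /\ V s b = v b) /\
  (forall s t : R, - e < s < e -> a <= t <= b -> in_Hplus (U s t, V s t)).

Definition horo_catenary (lam a b : R) (u v : R -> R) : Prop :=
  forall (e : R) (U V : R -> R -> R),
    variation a b u v e U V ->
    is_derive (fun s : R => energy_hor lam a b (U s) (V s)) 0 0.

Definition unit_normal (u v : R -> R) (t : R) : R * R :=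
  (v t * (- Derive v t / sqrt (speed2 u v t)),
   v t * (Derive u t / sqrt (speed2 u v t))).

(** Geodesic curvature with respect to [unit_normal]; [sqrt m ^ 3] is
    [m^(3/2)]. *)
Definition kappa_h (u v : R -> R) (t : R) : R :=
  v t * ((Derive u t * Derive_n v 2 t - Derive_n u 2 t * Derive v t)
         / sqrt (speed2 u v t) ^ 3)
  + Derive u t / sqrt (speed2 u v t).

(* Main.v *)
Require Import Defs.
From Stdlib Require Import Reals Lra Lia.
From Coquelicot Require Import Coquelicot.

Open Scope R_scope.

(** Write [f = u/v^2 + lam/v], so that the energy is the integral of
    [f * sqrt m]. Both Euler-Lagrange expressions are multiples of the single
    function [Q = f_u v' - f_v u' + f (u' v'' - u'' v') / m], namely
    [v' Q / sqrt m] and [- u' Q / sqrt m], and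
    [Q = 0] is the curvature equation up to a nonvanishing factor. The first
    variation in the direction [(xi, eta)] is therefore the integral of
    [Q (v' xi - u' eta) / sqrt m]. For the converse no bump functions are
    needed: [P = Q m v^3] is polynomial in the derivatives of [u] and [v], so
    [(xi, eta) = (t - a) (b - t) P (v', - u')] is a smooth direction vanishing
    at the endpoints, and it makes the first variation the integral of a
    nonnegative function that vanishes in [(a, b)] only where [Q] does. *)

(** * Pointwise calculus of the integrand and the curvature equation *)

Definition lagrangian (lam x y p q : R) : R :=
  (x / y + lam) * (sqrt (p ^ 2 + q ^ 2) / y).

(** The differential of [lagrangian] at [(x, y, p, q)] applied to [(x', y', p', q')]. Primes here
    are derivatives in the variation parameter, whereas in [euler_lagrange] they are derivatives
    along the curve. *)
Definition lagrangian_variation (lam x y p q x' y' p' q' : R) : R :=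
  (x' / y ^ 2 - (2 * x / y ^ 3 + lam / y ^ 2) * y') * sqrt (p ^ 2 + q ^ 2)
  + (x / y ^ 2 + lam / y) * (p * p' + q * q') / sqrt (p ^ 2 + q ^ 2).

(** The function [Q] of the overview at position [(x, y)], velocity [(p, q)] and acceleration
    [(p', q')], with [f_u = 1 / y^2] and [f_v = - (2 x / y^3 + lam / y^2)] substituted. *)
Definition euler_lagrange (lam x y p q p' q' : R) : R :=
  q / y ^ 2 + (2 * x / y ^ 3 + lam / y ^ 2) * p
  + (x / y ^ 2 + lam / y) * (p * q' - p' * q) / (p ^ 2 + q ^ 2).

Lemma is_derive_lagrangian (lam : R) (x y p q : R -> R) (s x' y' p' q' : R) :
  is_derive x s x' -> is_derive y s y' -> is_derive p s p' ->
  is_derive q s q' -> 0 < y s -> 0 < p s ^ 2 + q s ^ 2 ->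
  is_derive (fun s => lagrangian lam (x s) (y s) (p s) (q s)) s
    (lagrangian_variation lam (x s) (y s) (p s) (q s) x' y' p' q').
Proof.
intros Hx Hy Hp Hq y_gt0 m_gt0; unfold lagrangian, lagrangian_variation.
assert (r_gt0 := sqrt_lt_R0 _ m_gt0).
auto_derive.
- repeat split; try (now eexists; eassumption); try lra.
- change (fun x0 : R => x x0) with x; change (fun x0 : R => y x0) with y.
  change (fun x0 : R => p x0) with p; change (fun x0 : R => q x0) with q.
  rewrite (is_derive_unique _ _ _ Hx), (is_derive_unique _ _ _ Hy).
  rewrite (is_derive_unique _ _ _ Hp), (is_derive_unique _ _ _ Hq).
  replace (p s * (p s * 1) + q s * (q s * 1)) with (p s ^ 2 + q s ^ 2) by ring.
  set (r := sqrt _) in *.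
  field; lra.
Qed.

(** Integration by parts in pointwise form. The differentiated function is [L_p X + L_q Y] for the
    integrand [L], so integrating this identity trades the first variation for the Euler-Lagrange
    term and boundary values. *)
Lemma is_derive_boundary_term (lam : R) (x y X Y p q : R -> R)
  (t X' Y' p' q' : R) :
  is_derive x t (p t) -> is_derive y t (q t) -> is_derive p t p' ->
  is_derive q t q' -> is_derive X t X' -> is_derive Y t Y' ->
  0 < y t -> 0 < p t ^ 2 + q t ^ 2 ->
  is_derive (fun t => (x t / y t ^ 2 + lam / y t) * (p t * X t + q t * Y t)
                      / sqrt (p t ^ 2 + q t ^ 2)) t
    (lagrangian_variation lam (x t) (y t) (p t) (q t) (X t) (Y t) X' Y'
     - euler_lagrange lam (x t) (y t) (p t) (q t) p' q'
       / sqrt (p t ^ 2 + q t ^ 2) * (q t * X t - p t * Y t)).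
Proof.
intros Hx Hy Hp Hq HX HY y_gt0 m_gt0.
unfold lagrangian_variation, euler_lagrange.
assert (r_gt0 := sqrt_lt_R0 _ m_gt0).
auto_derive.
- repeat split; try (now eexists; eassumption); try lra.
  apply Rgt_not_eq, Rmult_lt_0_compat; lra.
  revert r_gt0; simpl; lra.
- change (fun x0 : R => x x0) with x; change (fun x0 : R => y x0) with y.
  change (fun x0 : R => p x0) with p; change (fun x0 : R => q x0) with q.
  change (fun x0 : R => X x0) with X; change (fun x0 : R => Y x0) with Y.
  rewrite (is_derive_unique _ _ _ Hx), (is_derive_unique _ _ _ Hy).
  rewrite (is_derive_unique _ _ _ Hp), (is_derive_unique _ _ _ Hq).
  rewrite (is_derive_unique _ _ _ HX), (is_derive_unique _ _ _ HY).
  replace (p t * (p t * 1) + q t * (q t * 1)) with (p t ^ 2 + q t ^ 2) by ring.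
  assert (r2 : p t ^ 2 + q t ^ 2 = sqrt (p t ^ 2 + q t ^ 2) ^ 2)
    by (rewrite pow2_sqrt; lra).
  revert r2 r_gt0; generalize (sqrt (p t ^ 2 + q t ^ 2)); intros r r2 r_gt0.
  rewrite !r2.
  (* The identity holds only modulo [p^2 + q^2 = r^2], hence [p^2] is eliminated. *)
  assert (p2 : p t ^ 2 = r ^ 2 - q t ^ 2) by lra.
  field [p2]; lra.
Qed.

Lemma speed2_gt0 (u v : R -> R) (t : R) :
  (Derive u t, Derive v t) <> (0, 0) -> 0 < speed2 u v t.
Proof.
unfold speed2; intros H.
destruct (Req_dec (Derive u t) 0) as [u0|u0];
  [destruct (Req_dec (Derive v t) 0) as [v0|v0]|].
- now rewrite u0, v0 in H.
- rewrite u0; generalize (pow2_gt_0 _ v0); lra.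
- generalize (pow2_gt_0 _ u0) (pow2_ge_0 (Derive v t)); lra.
Qed.

(** The difference of the two sides of the curvature equation is [Q] times
    [v^2 / (sqrt m (d_hor + lam))], and this factor is nonzero. *)
Lemma curvature_iff_euler_lagrange (lam : R) (u v : R -> R) (t : R) :
  0 < v t -> 0 < speed2 u v t -> d_hor (u t, v t) + lam <> 0 ->
  kappa_h u v t =
    hyp_metric (u t, v t) (unit_normal u v t) (W (u t, v t))
      / (d_hor (u t, v t) + lam) <->
  euler_lagrange lam (u t) (v t) (Derive u t) (Derive v t)
    (Derive_n u 2 t) (Derive_n v 2 t) = 0.
Proof.
intros v_gt0 m_gt0 nz.
assert (r_gt0 := sqrt_lt_R0 _ m_gt0).
assert (r2 : sqrt (speed2 u v t) ^ 2 = speed2 u v t)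
  by (rewrite pow2_sqrt; lra).
assert (E : kappa_h u v t -
    hyp_metric (u t, v t) (unit_normal u v t) (W (u t, v t))
      / (d_hor (u t, v t) + lam) =
  euler_lagrange lam (u t) (v t) (Derive u t) (Derive v t)
    (Derive_n u 2 t) (Derive_n v 2 t)
  * (v t ^ 2 / (sqrt (speed2 u v t) * (d_hor (u t, v t) + lam)))).
{ unfold kappa_h, hyp_metric, unit_normal, W, euler_lagrange.
  replace (Derive u t ^ 2 + Derive v t ^ 2) with (sqrt (speed2 u v t) ^ 2)
    by exact r2.
  unfold d_hor in *; simpl fst in *; simpl snd in *.
  field; repeat split; try lra.
  (* Clearing denominators leaves [u + lam v] to be nonzero, which is [d_hor + lam] multiplied by
     [v]. *)
  intros Hz; apply nz.
  replace (u t) with (- lam * v t) by lra; field; lra. }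
assert (K : v t ^ 2 / (sqrt (speed2 u v t) * (d_hor (u t, v t) + lam)) <> 0).
{ apply Rmult_integral_contrapositive_currified; [apply pow_nonzero; lra|].
  apply Rinv_neq_0_compat, Rmult_integral_contrapositive_currified; lra. }
split; intros H.
- rewrite H, Rminus_diag in E.
  symmetry in E; apply Rmult_integral in E; tauto.
- rewrite H, Rmult_0_l in E; lra.
Qed.

(** * Compactness, mixed partials and integrals on a closed interval *)

Lemma continuity_2d_pt_section (F : R -> R -> R) (s t : R) :
  continuity_2d_pt F s t -> continuous (F s) t.
Proof.
intros H; apply continuity_pt_filterlim.
intros eps eps_gt0.
destruct (H (mkposreal eps eps_gt0)) as [d Hd].
exists d; split; [apply cond_pos|].
intros t' [_ Ht']; apply Hd; [rewrite Rminus_diag, Rabs_R0; apply cond_pos|].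
exact Ht'.
Qed.

(** On the compact interval [F s0] attains a positive minimum. Uniform continuity, with this minimum
    as tolerance, keeps [F s] positive for [s] near [s0]. *)
Lemma uniform_gt0 (F : R -> R -> R) (a b s0 : R) :
  a <= b -> (forall t, a <= t <= b -> continuity_2d_pt F s0 t) ->
  (forall t, a <= t <= b -> 0 < F s0 t) ->
  locally s0 (fun s => forall t, a <= t <= b -> 0 < F s t).
Proof.
intros hab HF Fpos.
destruct (continuity_ab_min (F s0) a b hab) as [t0 [Hmin Ht0]].
{ intros t Ht; apply continuity_pt_filterlim.
  exact (continuity_2d_pt_section _ _ _ (HF t Ht)). }
destruct (uniform_continuity_2d_1d' F a b s0 HF (mkposreal _ (Fpos t0 Ht0)))
  as [d Hd].
exists d; intros s Hs t Ht.
assert (Hs' : Rabs (s - s0) < d) by exact Hs.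
apply Rabs_lt_between' in Hs'.
assert (d_gt0 := cond_pos d).
assert (K := Hd t s0 t s Ht ltac:(lra) Ht ltac:(lra)
               ltac:(rewrite Rminus_diag, Rabs_R0; lra)).
simpl in K; apply Rabs_lt_between in K; specialize (Hmin t Ht); lra.
Qed.

Lemma schwarz_C2 (F : R -> R -> R) (s t : R) :
  locally_2d (ex_diff_n F 2) s t ->
  Derive (fun z => Derive (fun y => F z y) t) s
  = Derive (fun y => Derive (fun z => F z y) s) t.
Proof.
intros H; apply Schwarz.
- revert H; apply locally_2d_impl, locally_2d_forall; intros x y H.
  destruct H as (_ & H1 & H2 & (_ & _ & H3 & _) & (_ & H4 & _)); auto.
- destruct (locally_2d_singleton _ _ _ H)
    as (_ & _ & _ & _ & (_ & _ & _ & (H1 & _) & _)); exact H1.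
- destruct (locally_2d_singleton _ _ _ H)
    as (_ & _ & _ & (_ & _ & _ & _ & (H1 & _)) & _); exact H1.
Qed.

(** The endpoints are limits of interior points, so continuity carries the equality over to them. *)
Lemma eq_closed_interval (f g : R -> R) (a b : R) :
  a < b -> (forall t, a <= t <= b -> continuous f t) ->
  (forall t, a <= t <= b -> continuous g t) ->
  (forall t, a < t < b -> f t = g t) ->
  forall t, a <= t <= b -> f t = g t.
Proof.
intros hab Hf Hg fg t Ht.
apply cond_eq; intros eps eps_gt0.
assert (Hc : continuous (fun t => f t - g t) t)
  by (apply (continuous_minus f g); auto).
apply continuity_pt_filterlim in Hc.
destruct (Hc eps eps_gt0) as [d [d_gt0 Hd]].
assert (exists t', a < t' < b /\ Rabs (t' - t) < d) as [t' [Ht' Htt']].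
(* A step of at most a quarter of the length towards the midpoint lands strictly inside the
   interval, even from an endpoint. *)
{ exists (t + Rmin (d / 2) ((b - a) / 4)
              * (if Rle_dec t ((a + b) / 2) then 1 else -1)).
  assert (H1 := Rmin_l (d / 2) ((b - a) / 4)).
  assert (H2 := Rmin_r (d / 2) ((b - a) / 4)).
  assert (H3 : 0 < Rmin (d / 2) ((b - a) / 4)) by (apply Rmin_pos; lra).
  destruct Rle_dec; split; try lra; apply Rabs_def1; lra. }
destruct (Req_dec t t') as [->|tt'].
{ rewrite fg, Rminus_diag, Rabs_R0; auto. }
assert (K : Rabs ((f t' - g t') - (f t - g t)) < eps)
  by (apply Hd; split; [split; [exact I|exact tt']|exact Htt']).
rewrite (fg _ Ht'), Rminus_diag in K.
now rewrite Rminus_0_l, Rabs_Ropp in K.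
Qed.

(** At an endpoint [Derive] also sees values outside [[a, b]], where [f] and [g] may differ. The
    derivatives are compared in the interior and continuity does the rest. *)
Lemma Derive_eq_closed_interval (f g : R -> R) (a b : R) :
  a < b -> (forall t, a <= t <= b -> continuous (Derive f) t) ->
  (forall t, a <= t <= b -> continuous (Derive g) t) ->
  (forall t, a <= t <= b -> f t = g t) ->
  forall t, a <= t <= b -> Derive f t = Derive g t.
Proof.
intros hab Hf Hg fg; apply eq_closed_interval; auto.
intros t Ht; apply Derive_ext_loc.
apply (locally_interval _ t a b); simpl; try lra.
intros x Hx1 Hx2; apply fg; simpl in *; lra.
Qed.

(** A positive value at an interior point persists on a small closed interval around it. Cutting the
    integral there into three gives two nonnegative pieces and a positive one. *)
Lemma RInt_eq0 (f : R -> R) (a b : R) :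
  a < b -> (forall t, a <= t <= b -> continuous f t) ->
  (forall t, a < t < b -> 0 <= f t) -> RInt f a b = 0 ->
  forall t, a < t < b -> f t = 0.
Proof.
intros hab Hf f_ge0 If t Ht.
destruct (f_ge0 t Ht) as [ft_gt0|]; [exfalso|auto].
assert (L : locally t (fun z => a < z < b /\ 0 < f z)).
{ apply filter_and.
  - apply (locally_interval _ t a b); simpl; try lra; auto.
  - apply (Hf t); [lra|]. exact (open_gt 0 _ ft_gt0). }
destruct L as [d Hd].
assert (d_gt0 := cond_pos d).
assert (Hd' : forall z, t - d / 2 <= z <= t + d / 2 -> a < z < b /\ 0 < f z).
{ intros z Hz; apply Hd; apply (Rabs_def1 (z - t)); lra. }
assert (K1 := proj1 (Hd' (t - d / 2) ltac:(lra))).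
assert (K2 := proj1 (Hd' (t + d / 2) ltac:(lra))).
assert (ex : forall c e, a <= c -> c <= e -> e <= b -> ex_RInt f c e).
{ intros c e H1 H2 H3; apply (ex_RInt_continuous (V := R_CompleteNormedModule)).
  rewrite Rmin_left, Rmax_right by lra; intros z Hz; apply Hf; lra. }
assert (P1 : 0 <= RInt f a (t - d / 2))
  by (apply RInt_ge_0; [lra|apply ex; lra|intros; apply f_ge0; lra]).
assert (P2 : 0 <= RInt f (t + d / 2) b)
  by (apply RInt_ge_0; [lra|apply ex; lra|intros; apply f_ge0; lra]).
assert (P3 : 0 < RInt f (t - d / 2) (t + d / 2)).
{ apply RInt_gt_0; [lra| |].
  - intros z Hz; apply Hd'; lra.
  - intros z Hz; apply Hf; lra. }
rewrite <- (RInt_Chasles f a (t - d / 2) b) in If by (apply ex; lra).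
rewrite <- (RInt_Chasles f (t - d / 2) (t + d / 2) b) in If by (apply ex; lra).
unfold plus in If; simpl in If; lra.
Qed.

(** * Continuity of the integrands *)

Lemma continuous_inv {T : UniformSpace} (f : T -> R) (x : T) :
  continuous f x -> f x <> 0 -> continuous (fun z => / f z) x.
Proof.
intros Hf f0; apply (continuous_comp f Rinv); auto; now apply continuous_Rinv.
Qed.

Ltac prove_continuous :=
  repeat match goal with
  | H : continuous ?f ?x |- continuous ?f ?x => exact H
  | |- continuous (fun _ => ?c) _ => apply continuous_const
  | |- continuous (fun z => _ + _) _ =>
      apply (continuous_plus (V := R_NormedModule))
  | |- continuous (fun z => _ - _) _ =>
      apply (continuous_minus (V := R_NormedModule))
  | |- continuous (fun z => _ * _) _ =>
      apply (continuous_mult (K := R_AbsRing))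
  | |- continuous (fun z => / _) _ => apply continuous_inv
  | |- continuous (fun z => sqrt _) _ =>
      apply (continuous_comp _ sqrt); [|apply continuous_sqrt]
  end.

Lemma continuous_lagrangian {T : UniformSpace} (lam : R) (x y p q : T -> R)
  (z : T) :
  continuous x z -> continuous y z -> continuous p z -> continuous q z ->
  0 < y z ->
  continuous (fun z => lagrangian lam (x z) (y z) (p z) (q z)) z.
Proof.
intros; unfold lagrangian, Rdiv; simpl pow; prove_continuous; lra.
Qed.

Lemma continuous_lagrangian_variation {T : UniformSpace} (lam : R)
  (x y p q x' y' p' q' : T -> R) (z : T) :
  continuous x z -> continuous y z -> continuous p z -> continuous q z ->
  continuous x' z -> continuous y' z -> continuous p' z -> continuous q' z ->
  0 < y z -> 0 < p z ^ 2 + q z ^ 2 ->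
  continuous (fun z => lagrangian_variation lam (x z) (y z) (p z) (q z)
    (x' z) (y' z) (p' z) (q' z)) z.
Proof.
intros Hx Hy Hp Hq Hx' Hy' Hp' Hq' y_gt0 m_gt0.
assert (r_gt0 := sqrt_lt_R0 _ m_gt0).
unfold lagrangian_variation, Rdiv; simpl pow in *; prove_continuous;
  apply Rgt_not_eq; repeat apply Rmult_lt_0_compat; lra.
Qed.

(** Joint continuity is continuity on the product space, so the previous lemma applies with [T]
    equal to [R * R]. *)
Lemma continuity_2d_lagrangian_variation (lam : R)
  (x y p q x' y' p' q' : R -> R -> R) (s t : R) :
  continuity_2d_pt x s t -> continuity_2d_pt y s t ->
  continuity_2d_pt p s t -> continuity_2d_pt q s t ->
  continuity_2d_pt x' s t -> continuity_2d_pt y' s t ->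
  continuity_2d_pt p' s t -> continuity_2d_pt q' s t ->
  0 < y s t -> 0 < p s t ^ 2 + q s t ^ 2 ->
  continuity_2d_pt (fun s t => lagrangian_variation lam (x s t) (y s t)
    (p s t) (q s t) (x' s t) (y' s t) (p' s t) (q' s t)) s t.
Proof.
rewrite !continuity_2d_pt_filterlim.
exact (fun Hx Hy Hp Hq Hx' Hy' Hp' Hq' =>
  continuous_lagrangian_variation lam _ _ _ _ _ _ _ _ (s, t)
    Hx Hy Hp Hq Hx' Hy' Hp' Hq').
Qed.

Lemma continuous_euler_lagrange {T : UniformSpace} (lam : R)
  (x y p q p' q' : T -> R) (z : T) :
  continuous x z -> continuous y z -> continuous p z -> continuous q z ->
  continuous p' z -> continuous q' z -> 0 < y z -> 0 < p z ^ 2 + q z ^ 2 ->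
  continuous (fun z =>
    euler_lagrange lam (x z) (y z) (p z) (q z) (p' z) (q' z)) z.
Proof.
intros Hx Hy Hp Hq Hp' Hq' y_gt0 m_gt0.
unfold euler_lagrange, Rdiv; simpl pow in *; prove_continuous;
  apply Rgt_not_eq; repeat apply Rmult_lt_0_compat; lra.
Qed.

(** * The first variation formula *)

(** Differentiate under the integral sign, then integrate by parts; fixed endpoints kill the
    boundary term. Regularity is assumed at [s = 0] only and extends to nearby [s] by
    compactness. *)
Lemma first_variation (lam a b e d : R) (U V : R -> R -> R) :
  a < b -> 0 < e -> 0 < d ->
  (forall s t, - e < s < e -> a - d < t < b + d ->
     ex_diff_n U 2 s t /\ ex_diff_n V 2 s t) ->
  (forall s t, - e < s < e -> a <= t <= b -> 0 < V s t) ->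
  (forall t, a <= t <= b -> 0 < speed2 (U 0) (V 0) t) ->
  (forall s, - e < s < e ->
     U s a = U 0 a /\ V s a = V 0 a /\ U s b = U 0 b /\ V s b = V 0 b) ->
  is_derive (fun s => energy_hor lam a b (U s) (V s)) 0
    (RInt (fun t =>
       euler_lagrange lam (U 0 t) (V 0 t) (Derive (U 0) t) (Derive (V 0) t)
         (Derive_n (U 0) 2 t) (Derive_n (V 0) 2 t)
       / sqrt (speed2 (U 0) (V 0) t)
       * (Derive (V 0) t * Derive (fun s => U s t) 0
          - Derive (U 0) t * Derive (fun s => V s t) 0)) a b).
Proof.
intros hab e_gt0 d_gt0 HUV V_gt0 m_gt0 Hends.
assert (box : forall s t, - e < s < e -> a - d < t < b + d ->
  locally_2d (fun s t => - e < s < e /\ a - d < t < b + d) s t).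
{ intros s t Hs Ht.
  assert (H : 0 < Rmin (Rmin (s + e) (e - s)) (Rmin (t - (a - d)) (b + d - t)))
    by (repeat apply Rmin_pos; lra).
  exists (mkposreal _ H); simpl; intros u v Hu Hv.
  apply Rabs_lt_between in Hu; apply Rabs_lt_between in Hv.
  assert (M1 := Rmin_l (Rmin (s + e) (e - s)) (Rmin (t - (a - d)) (b + d - t))).
  assert (M2 := Rmin_r (Rmin (s + e) (e - s)) (Rmin (t - (a - d)) (b + d - t))).
  assert (M3 := Rmin_l (s + e) (e - s)).
  assert (M4 := Rmin_r (s + e) (e - s)).
  assert (M5 := Rmin_l (t - (a - d)) (b + d - t)).
  assert (M6 := Rmin_r (t - (a - d)) (b + d - t)).
  lra. }
(* Subscripts record the order of differentiation: [Uts] is the [s]-derivative of [Ut]. [G] is the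
   [s]-derivative of the integrand [L]. *)
set (Ut := fun s t => Derive (fun z => U s z) t).
set (Vt := fun s t => Derive (fun z => V s z) t).
set (Us := fun s t => Derive (fun z => U z t) s).
set (Vs := fun s t => Derive (fun z => V z t) s).
set (L := fun s t => lagrangian lam (U s t) (V s t) (Ut s t) (Vt s t)).
set (Uts := fun s t => Derive (fun z => Ut z t) s).
set (Vts := fun s t => Derive (fun z => Vt z t) s).
set (G := fun s t => lagrangian_variation lam (U s t) (V s t) (Ut s t) (Vt s t)
            (Us s t) (Vs s t) (Uts s t) (Vts s t)).
assert (dG : forall s t, - e < s < e -> a - d < t < b + d -> 0 < V s t ->
  0 < Ut s t ^ 2 + Vt s t ^ 2 ->
  is_derive (fun s => L s t) s (G s t)).
{ intros s t Hs Ht V_gt0' m_gt0'.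
  destruct (HUV s t Hs Ht) as [(_ & HU1 & _ & _ & (_ & HU2 & _))
                               (_ & HV1 & _ & _ & (_ & HV2 & _))].
  apply (is_derive_lagrangian lam (fun s => U s t) (fun s => V s t)
           (fun s => Ut s t) (fun s => Vt s t)); auto; now apply Derive_correct. }
assert (cG : forall t, a <= t <= b -> continuity_2d_pt G 0 t).
{ intros t Ht.
  destruct (HUV 0 t ltac:(lra) ltac:(lra))
    as [(HU1 & _ & _ & (HU2 & _) & (HU3 & _ & _ & (HU4 & _) & _))
        (HV1 & _ & _ & (HV2 & _) & (HV3 & _ & _ & (HV4 & _) & _))].
  apply continuity_2d_lagrangian_variation; auto.
  - apply V_gt0; lra.
  - exact (m_gt0 t Ht). }
assert (near0 : locally 0 (fun s => - e < s < e)).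
{ apply (locally_interval _ 0 (- e) e); simpl; try lra; auto. }
assert (cm : forall t, a <= t <= b ->
  continuity_2d_pt (fun s t => Ut s t ^ 2 + Vt s t ^ 2) 0 t).
{ intros t Ht.
  destruct (HUV 0 t ltac:(lra) ltac:(lra))
    as [(_ & _ & _ & _ & (HU3 & _)) (_ & _ & _ & _ & (HV3 & _))].
  simpl pow.
  repeat first [assumption | apply continuity_2d_pt_plus
                | apply continuity_2d_pt_mult | apply continuity_2d_pt_const]. }
assert (posm : locally 0 (fun s => forall t, a <= t <= b ->
                           0 < Ut s t ^ 2 + Vt s t ^ 2)).
{ apply (uniform_gt0 (fun s t => Ut s t ^ 2 + Vt s t ^ 2)); auto; lra. }
assert (ends : forall s, - e < s < e -> forall t,
  (t = a \/ t = b) -> U s t = U 0 t /\ V s t = V 0 t).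
{ intros s Hs t Ht; destruct (Hends s Hs) as (? & ? & ? & ?).
  destruct Ht; subst; auto. }
(* The endpoints do not move with [s], so the variation field vanishes there. *)
assert (ends0 : forall t, (t = a \/ t = b) -> Us 0 t = 0 /\ Vs 0 t = 0).
{ intros t Ht; unfold Us, Vs; split.
  - rewrite (Derive_ext_loc _ (fun _ => U 0 t)); [apply Derive_const|].
    revert near0; apply filter_imp; intros s Hs; now apply ends.
  - rewrite (Derive_ext_loc _ (fun _ => V 0 t)); [apply Derive_const|].
    revert near0; apply filter_imp; intros s Hs; now apply ends. }
set (EL := fun t =>
       euler_lagrange lam (U 0 t) (V 0 t) (Ut 0 t) (Vt 0 t)
         (Derive_n (U 0) 2 t) (Derive_n (V 0) 2 t)
       / sqrt (Ut 0 t ^ 2 + Vt 0 t ^ 2)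
       * (Vt 0 t * Us 0 t - Ut 0 t * Vs 0 t)).
change (is_derive (fun s => RInt (fun t => L s t) a b) 0 (RInt EL a b)).
assert (cG0 : forall t, a <= t <= b -> continuous (G 0) t).
{ intros t Ht; apply continuity_2d_pt_section; auto. }
assert (cEL : forall t, a <= t <= b -> continuous EL t).
{ intros t Ht.
  destruct (HUV 0 t ltac:(lra) ltac:(lra))
    as [(HU1 & _ & _ & (HU2 & _) & (HU3 & _ & _ & _ & (HU4 & _)))
        (HV1 & _ & _ & (HV2 & _) & (HV3 & _ & _ & _ & (HV4 & _)))].
  apply continuity_2d_pt_section in HU1, HU2, HU3, HU4, HV1, HV2, HV3, HV4.
  assert (Hr := cm t Ht); apply continuity_2d_pt_section in Hr.
  assert (r_gt0 := sqrt_lt_R0 _ (m_gt0 t Ht)).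
  apply (continuous_mult (K := R_AbsRing)).
  - apply (continuous_mult (K := R_AbsRing)).
    + apply continuous_euler_lagrange; auto.
      * apply V_gt0; lra.
      * exact (m_gt0 t Ht).
    + apply continuous_comp; [|apply continuous_Rinv; apply Rgt_not_eq; exact r_gt0].
      apply (continuous_comp _ sqrt); [exact Hr|apply continuous_sqrt].
  - apply (continuous_minus (V := R_NormedModule));
      apply (continuous_mult (K := R_AbsRing)); auto. }
assert (dB : forall t, a <= t <= b -> is_derive
   (fun t => (U 0 t / V 0 t ^ 2 + lam / V 0 t) * (Ut 0 t * Us 0 t + Vt 0 t * Vs 0 t)
                      / sqrt (Ut 0 t ^ 2 + Vt 0 t ^ 2)) t (G 0 t - EL t)).
{ intros t Ht.
  destruct (HUV 0 t ltac:(lra) ltac:(lra))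
    as [(_ & _ & HU1 & (_ & _ & HU2 & _) & (_ & _ & HU3 & _))
        (_ & _ & HV1 & (_ & _ & HV2 & _) & (_ & _ & HV3 & _))].
  (* The integrand [G] contains the [s]-derivative of [Ut], while the boundary term produces the
     [t]-derivative of [Us]; symmetry of mixed partials identifies them. *)
  assert (SU := schwarz_C2 U 0 t); assert (SV := schwarz_C2 V 0 t).
  assert (Hbox := box 0 t ltac:(lra) ltac:(lra)).
  assert (LU : locally_2d (ex_diff_n U 2) 0 t).
  { revert Hbox; apply locally_2d_impl, locally_2d_forall.
    intros x y [Hx Hy]; now apply HUV. }
  assert (LV : locally_2d (ex_diff_n V 2) 0 t).
  { revert Hbox; apply locally_2d_impl, locally_2d_forall.
    intros x y [Hx Hy]; now apply HUV. }
  specialize (SU LU); specialize (SV LV).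
  apply (is_derive_boundary_term lam (U 0) (V 0) (Us 0) (Vs 0) (Ut 0) (Vt 0)).
  - now apply Derive_correct.
  - now apply Derive_correct.
  - now apply (Derive_correct (Ut 0)).
  - now apply (Derive_correct (Vt 0)).
  - unfold Uts, Ut; rewrite SU; now apply (Derive_correct (Us 0)).
  - unfold Vts, Vt; rewrite SV; now apply (Derive_correct (Vs 0)).
  - apply V_gt0; lra.
  - exact (m_gt0 t Ht). }
(* By the fundamental theorem of calculus the integral is a difference of boundary terms, both zero
   by [ends0]. *)
assert (IB : is_RInt (fun t => G 0 t - EL t) a b 0).
{ assert (K := is_RInt_derive (V := R_CompleteNormedModule) _
    (fun t => G 0 t - EL t) a b
    ltac:(rewrite Rmin_left, Rmax_right by lra; exact dB)).
  cbv beta in K.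
  destruct (ends0 a ltac:(auto)) as [-> ->] in K.
  destruct (ends0 b ltac:(auto)) as [-> ->] in K.
  rewrite !Rmult_0_r, Rplus_0_r, !Rmult_0_r, !Rdiv_0_l in K.
  rewrite minus_eq_zero in K; apply K.
  rewrite Rmin_left, Rmax_right by lra; intros t Ht.
  apply (continuous_minus (V := R_NormedModule)); auto. }
assert (eEL : ex_RInt EL a b).
{ apply (ex_RInt_continuous (V := R_CompleteNormedModule)).
  now rewrite Rmin_left, Rmax_right by lra. }
assert (RInt (fun t => Derive (fun s => L s t) 0) a b = RInt EL a b) as <-.
{ apply is_RInt_unique.
  apply (is_RInt_ext (fun t => plus (G 0 t - EL t) (EL t))).
  - rewrite Rmin_left, Rmax_right by lra; intros t Ht.
    symmetry; apply is_derive_unique.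
    replace (plus _ _) with (G 0 t) by (unfold plus; simpl; ring).
    apply dG; try lra.
    + apply V_gt0; lra.
    + apply (m_gt0 t); lra.
  - rewrite <- (plus_zero_l (RInt EL a b)).
    apply (is_RInt_plus (V := R_NormedModule)); [exact IB|].
    now apply (RInt_correct (V := R_CompleteNormedModule)). }
(* What remains is differentiability of [L] in [s] near [0], joint continuity of that derivative at
   [(0, t)], and integrability of [L s]. *)
apply (is_derive_RInt_param L); rewrite ?Rmin_left, ?Rmax_right by lra.
- generalize (filter_and _ _ near0 posm); apply filter_imp.
  intros s [Hs Hm] t Ht; eexists; apply dG; auto; lra.
- intros t Ht; apply (continuity_2d_pt_ext_loc G); [|now apply cG].
  assert (HV1 : continuity_2d_pt V 0 t)
    by (destruct (HUV 0 t ltac:(lra) ltac:(lra)) as [_ [? _]]; auto).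
  assert (pos : forall F, continuity_2d_pt F 0 t -> 0 < F 0 t ->
    locally_2d (fun s t => 0 < F s t) 0 t).
  { intros F HF Fpos; specialize (HF (mkposreal _ Fpos)).
    revert HF; apply locally_2d_impl, locally_2d_forall; intros x y H.
    apply Rabs_lt_between in H; simpl in H; lra. }
  (* [G] is known to be the derivative of [L] only where [V] and the squared speed are positive,
     which holds on a neighbourhood of [(0, t)]. *)
  assert (near := locally_2d_and _ _ _ _ (box 0 t ltac:(lra) ltac:(lra))
    (locally_2d_and _ _ _ _ (pos V HV1 (V_gt0 0 t ltac:(lra) Ht))
       (pos _ (cm t Ht) (m_gt0 t Ht)))).
  revert near; apply locally_2d_impl, locally_2d_forall.
  intros x y ((Hx & Hy) & H1 & H2).
  symmetry; apply is_derive_unique; auto.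
- revert near0; apply filter_imp; intros s Hs.
  apply (ex_RInt_continuous (V := R_CompleteNormedModule)).
  rewrite Rmin_left, Rmax_right by lra; intros t Ht.
  destruct (HUV s t ltac:(lra) ltac:(lra))
    as [(HU1 & _ & _ & _ & (HU3 & _)) (HV1 & _ & _ & _ & (HV3 & _))].
  apply continuity_2d_pt_section in HU1, HU3, HV1, HV3.
  apply (continuous_lagrangian lam (U s) (V s) (Ut s) (Vt s)); auto.
Qed.

(** * Smooth functions on an open interval *)

(** [smooth_on a b f] unfolds to [smooth_between (a - d) (b + d) f] for some positive [d]. Naming
    the open interval lets several functions share one. *)
Definition smooth_between (c d : R) (f : R -> R) : Prop :=
  forall t, c < t < d -> forall n, ex_derive_n f n t.

Lemma locally_between (c d t : R) :
  c < t < d -> locally t (fun z => c < z < d).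
Proof.
intros Ht; apply (locally_interval _ t c d); simpl; try apply Ht; auto.
Qed.

Lemma Derive_n_Derive (f : R -> R) (n : nat) (t : R) :
  Derive_n (Derive f) n t = Derive_n f (S n) t.
Proof.
rewrite <- (Nat.add_1_r n), <- Derive_n_comp; reflexivity.
Qed.

Lemma ex_derive_n_S (f : R -> R) (n : nat) (t : R) :
  ex_derive f t -> ex_derive_n (Derive f) n t -> ex_derive_n f (S n) t.
Proof.
destruct n as [|n]; intros H1 H2; [exact H1|].
apply (ex_derive_ext (Derive_n (Derive f) n)); [|exact H2].
intros z; apply Derive_n_Derive.
Qed.

Section Smooth.

Variables c d : R.

Lemma smooth_between_weaken (c' d' : R) (f : R -> R) :
  c' <= c -> d <= d' -> smooth_between c' d' f -> smooth_between c d f.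
Proof. intros Hc Hd H t Ht; apply H; lra. Qed.

Lemma smooth_between_ex_derive (f : R -> R) (t : R) :
  smooth_between c d f -> c < t < d -> ex_derive f t.
Proof. intros H Ht; exact (H t Ht 1%nat). Qed.

Lemma smooth_between_continuous (f : R -> R) (t : R) :
  smooth_between c d f -> c < t < d -> continuous f t.
Proof.
intros H Ht; apply (ex_derive_continuous f t).
now apply smooth_between_ex_derive.
Qed.

Lemma smooth_between_Derive (f : R -> R) :
  smooth_between c d f -> smooth_between c d (Derive f).
Proof.
intros H t Ht [|n]; [exact I|].
apply (ex_derive_ext (Derive_n f (S n))); [|exact (H t Ht (S (S n)))].
intros z; symmetry; apply Derive_n_Derive.
Qed.

Lemma smooth_between_const (k : R) : smooth_between c d (fun _ => k).
Proof. intros t _ n; apply ex_derive_n_const. Qed.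

Lemma smooth_between_id : smooth_between c d (fun t => t).
Proof.
intros t Ht [|n]; [exact I|].
apply ex_derive_n_S; [apply ex_derive_id|].
apply (ex_derive_n_ext (fun _ => 1)); [|apply ex_derive_n_const].
intros z; now rewrite Derive_id.
Qed.

Lemma smooth_between_plus (f g : R -> R) :
  smooth_between c d f -> smooth_between c d g ->
  smooth_between c d (fun t => f t + g t).
Proof.
intros Hf Hg t Ht n; apply ex_derive_n_plus;
  generalize (locally_between _ _ _ Ht); apply filter_imp; auto.
Qed.

Lemma smooth_between_mult (f g : R -> R) :
  smooth_between c d f -> smooth_between c d g ->
  smooth_between c d (fun t => f t * g t).
Proof.
intros Hf Hg t Ht n.
(* The product rule replaces the pair by [(f', g)] and [(f, g')], so the induction ranges over all
   pairs. The bound [N] supplies every order up to [n], as the sum rule requires. *)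
assert (K : forall N f g, smooth_between c d f -> smooth_between c d g ->
  forall t, c < t < d -> forall n, (n <= N)%nat ->
  ex_derive_n (fun t => f t * g t) n t); [|apply (K n); auto].
clear; induction N as [|N IH]; intros f g Hf Hg t Ht [|n] Hn;
  try exact I; [lia|].
apply ex_derive_n_S.
- apply (ex_derive_mult f g); now apply smooth_between_ex_derive.
- apply (ex_derive_n_ext_loc (fun t => Derive f t * g t + f t * Derive g t)).
  + generalize (locally_between _ _ _ Ht); apply filter_imp; intros z Hz.
    symmetry; apply Derive_mult; now apply smooth_between_ex_derive.
  + apply ex_derive_n_plus; generalize (locally_between _ _ _ Ht);
      apply filter_imp; intros z Hz k Hk; apply IH; auto; try lia;
      now apply smooth_between_Derive.
Qed.

(** Families affine in [s] are closed under both partial derivatives: [d/ds] gives the pair [(g, 0)]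
    and [d/dt] the pair [(f', g')]. Induction on the order then applies. *)
Lemma ex_diff_n_affine (f g : R -> R) (n : nat) (s t : R) :
  smooth_between c d f -> smooth_between c d g -> c < t < d ->
  ex_diff_n (fun s t => f t + s * g t) n s t.
Proof.
revert f g s t; induction n as [|n IH]; intros f g s t Hf Hg Ht.
all: assert (C : continuity_2d_pt (fun s t => f t + s * g t) s t) by
 (apply continuity_2d_pt_plus;
   [apply (continuity_1d_2d_pt_comp f (fun _ t => t))
   |apply continuity_2d_pt_mult; [apply continuity_2d_pt_id1|];
    apply (continuity_1d_2d_pt_comp g (fun _ t => t))];
   try apply continuity_2d_pt_id2;
   apply continuity_pt_filterlim; now apply smooth_between_continuous).
{ now split. }
assert (L : forall s t, c < t < d -> locally_2d (fun _ t => c < t < d) s t).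
{ intros x y Hy; destruct (locally_between _ _ _ Hy) as [r Hr].
  exists r; intros x' y' _ Hy'; now apply Hr. }
assert (ds : forall s t, is_derive (fun z => f t + z * g t) s (g t)).
{ intros x y; auto_derive; [exact I|ring]. }
assert (dt : forall s t, c < t < d ->
  is_derive (fun z => f z + s * g z) t (Derive f t + s * Derive g t)).
{ intros x y Hy.
  apply (is_derive_plus f (fun z => x * g z)).
  - now apply Derive_correct, smooth_between_ex_derive.
  - apply is_derive_scal.
    now apply Derive_correct, smooth_between_ex_derive. }
repeat split; auto.
- eexists; apply ds.
- eexists; now apply dt.
- apply (ex_diff_n_ext_loc (fun s t => g t + s * 0)).
  + apply locally_2d_forall; intros x y; symmetry.
    rewrite Rmult_0_r, Rplus_0_r; apply is_derive_unique, ds.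
  + apply (IH g (fun _ => 0)); auto using smooth_between_const.
- apply (ex_diff_n_ext_loc (fun s t => Derive f t + s * Derive g t)).
  + generalize (L s t Ht); apply locally_2d_impl, locally_2d_forall.
    intros x y Hy; symmetry; now apply is_derive_unique, dt.
  + apply (IH (Derive f) (Derive g)); auto using smooth_between_Derive.
Qed.

End Smooth.

Ltac prove_smooth :=
  repeat match goal with
  | H : smooth_between ?c ?d ?f |- smooth_between ?c ?d ?f => exact H
  | |- smooth_between _ _ (fun _ => ?k) => apply smooth_between_const
  | |- smooth_between _ _ (fun t => t) => apply smooth_between_id
  | |- smooth_between _ _ (fun t => _ + _) => apply smooth_between_plus
  | |- smooth_between _ _ (fun t => _ * _) => apply smooth_between_mult
  end.

(** * Variations of a given curve *)

(** A variation at [s = 0] agrees with the curve on [[a, b]] only, so the derivatives of [U 0] and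
    [V 0] must be matched with those of [u] and [v] before [first_variation] applies. *)
Lemma first_variation_curve (lam a b e : R) (u v : R -> R) (U V : R -> R -> R) :
  a < b -> smooth_regular_curve a b u v -> variation a b u v e U V ->
  is_derive (fun s => energy_hor lam a b (U s) (V s)) 0
    (RInt (fun t =>
       euler_lagrange lam (u t) (v t) (Derive u t) (Derive v t)
         (Derive_n u 2 t) (Derive_n v 2 t) / sqrt (speed2 u v t)
       * (Derive v t * Derive (fun s => U s t) 0
          - Derive u t * Derive (fun s => V s t) 0)) a b).
Proof.
intros hab ([du [du_gt0 Hu]] & [dv [dv_gt0 Hv]] & Hplus & Hreg)
  (e_gt0 & [dU [dU_gt0 HU]] & [dV [dV_gt0 HV]] & H0 & Hends & HplusUV).
assert (m1 := Rmin_l dU dV); assert (m2 := Rmin_r dU dV).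
assert (cD : forall f df F dF, 0 < df -> 0 < dF ->
  smooth_between (a - df) (b + df) f ->
  (forall s t, - e < s < e -> a - dF < t < b + dF -> forall n, ex_diff_n F n s t) ->
  (forall t, a <= t <= b -> F 0 t = f t) ->
  forall t, a <= t <= b -> Derive (F 0) t = Derive f t).
{ intros f df F dF df_gt0 dF_gt0 Hf HF Ff; apply Derive_eq_closed_interval; auto.
  - intros t Ht; destruct (HF 0 t ltac:(lra) ltac:(lra) 1%nat)
      as (_ & _ & _ & _ & (C & _)).
    exact (continuity_2d_pt_section _ _ _ C).
  - intros t Ht; apply (smooth_between_continuous (a - df) (b + df)); [|lra].
    now apply smooth_between_Derive. }
assert (DU := cD u du U dU du_gt0 dU_gt0 Hu HU (fun t Ht => proj1 (H0 t Ht))).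
assert (DV := cD v dv V dV dv_gt0 dV_gt0 Hv HV (fun t Ht => proj2 (H0 t Ht))).
clear cD.
(* Second derivatives occur only under the integral, where agreement on the open interval
   suffices. *)
assert (D2 : forall f F : R -> R, (forall t, a <= t <= b -> F t = f t) ->
  forall t, a < t < b -> Derive_n F 2 t = Derive_n f 2 t).
{ intros f F Ff t Ht; apply Derive_n_ext_loc.
  generalize (locally_between _ _ _ Ht); apply filter_imp; intros z Hz.
  apply Ff; lra. }
rewrite (RInt_ext _ (fun t =>
       euler_lagrange lam (U 0 t) (V 0 t) (Derive (U 0) t) (Derive (V 0) t)
         (Derive_n (U 0) 2 t) (Derive_n (V 0) 2 t)
       / sqrt (speed2 (U 0) (V 0) t)
       * (Derive (V 0) t * Derive (fun s => U s t) 0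
          - Derive (U 0) t * Derive (fun s => V s t) 0))).
2:{ rewrite Rmin_left, Rmax_right by lra; intros t Ht; unfold speed2.
  rewrite (D2 u (U 0)), (D2 v (V 0)) by (auto; intros; now apply H0).
  rewrite DU, DV by lra.
  destruct (H0 t ltac:(lra)) as [-> ->]; reflexivity. }
apply (first_variation lam a b e (Rmin dU dV)); auto.
- now apply Rmin_pos.
- intros s t Hs Ht; split; [apply HU|apply HV]; auto; lra.
- intros s t Hs Ht; now apply HplusUV.
- intros t Ht; unfold speed2; rewrite DU, DV by auto.
  now apply speed2_gt0, Hreg.
- intros s Hs; destruct (H0 a ltac:(lra)) as [-> ->].
  destruct (H0 b ltac:(lra)) as [-> ->]; now apply Hends.
Qed.

(** Positivity of both coordinates on the compact interval survives small multiples of [(xi, eta)];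
    how small determines [e]. *)
Lemma affine_variation (a b d : R) (u v xi eta : R -> R) :
  a <= b -> 0 < d ->
  smooth_between (a - d) (b + d) u -> smooth_between (a - d) (b + d) v ->
  smooth_between (a - d) (b + d) xi -> smooth_between (a - d) (b + d) eta ->
  (forall t, a <= t <= b -> in_Hplus (u t, v t)) ->
  xi a = 0 -> xi b = 0 -> eta a = 0 -> eta b = 0 ->
  exists e, variation a b u v e
    (fun s t => u t + s * xi t) (fun s t => v t + s * eta t).
Proof.
intros hab d_gt0 Hu Hv Hxi Heta Hplus xia xib etaa etab.
assert (L : locally 0 (fun s => forall t, a <= t <= b ->
              in_Hplus (u t + s * xi t, v t + s * eta t))).
{ assert (P : forall f g, smooth_between (a - d) (b + d) f ->
    smooth_between (a - d) (b + d) g ->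
    (forall t, a <= t <= b -> 0 < f t) ->
    locally 0 (fun s => forall t, a <= t <= b -> 0 < f t + s * g t)).
  { intros f g Hf Hg f_gt0.
    apply (uniform_gt0 (fun s t => f t + s * g t)); auto.
    - intros t Ht.
      apply (ex_diff_n_affine (a - d) (b + d) f g 0 0 t Hf Hg); lra.
    - intros t Ht; rewrite Rmult_0_l, Rplus_0_r; auto. }
  generalize (filter_and _ _
    (P u xi Hu Hxi (fun t Ht => proj1 (Hplus t Ht)))
    (P v eta Hv Heta (fun t Ht => proj2 (Hplus t Ht)))).
  apply filter_imp; intros s [H1 H2] t Ht; split; simpl; auto. }
destruct L as [e He]; exists e.
assert (e_gt0 := cond_pos e).
repeat split; auto.
- exists d; split; auto; intros; now apply (ex_diff_n_affine (a - d) (b + d)).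
- exists d; split; auto; intros; now apply (ex_diff_n_affine (a - d) (b + d)).
- ring.
- ring.
- rewrite xia; ring.
- rewrite etaa; ring.
- rewrite xib; ring.
- rewrite etab; ring.
- apply He; auto; apply Rabs_def1; unfold minus, plus, opp; simpl; lra.
- apply He; auto; apply Rabs_def1; unfold minus, plus, opp; simpl; lra.
Qed.

(** * Equivalence with the Euler-Lagrange equation *)

(** The function [P = Q m v^3] of the overview, written with sums and products only, the operations
    that [prove_smooth] handles. *)
Definition euler_numerator (lam : R) (u v : R -> R) (t : R) : R :=
  (Derive v t * v t + (2 * u t + lam * v t) * Derive u t)
    * (Derive u t * Derive u t + Derive v t * Derive v t)
  + (u t * v t + lam * (v t * v t))
    * (Derive u t * Derive_n v 2 t + - 1 * (Derive_n u 2 t * Derive v t)).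

Lemma euler_numeratorE (lam : R) (u v : R -> R) (t : R) :
  0 < v t -> 0 < speed2 u v t ->
  euler_lagrange lam (u t) (v t) (Derive u t) (Derive v t)
    (Derive_n u 2 t) (Derive_n v 2 t)
  = euler_numerator lam u v t / (speed2 u v t * v t ^ 3).
Proof.
unfold speed2; intros v_gt0 m_gt0; unfold euler_lagrange, euler_numerator.
field; lra.
Qed.

Lemma smooth_between_euler_numerator (lam c d : R) (u v : R -> R) :
  smooth_between c d u -> smooth_between c d v ->
  smooth_between c d (euler_numerator lam u v).
Proof.
intros Hu Hv.
assert (Hu1 := smooth_between_Derive _ _ _ Hu).
assert (Hv1 := smooth_between_Derive _ _ _ Hv).
assert (Hu2 := smooth_between_Derive _ _ _ Hu1).
assert (Hv2 := smooth_between_Derive _ _ _ Hv1).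
change (smooth_between c d (Derive_n u 2)) in Hu2.
change (smooth_between c d (Derive_n v 2)) in Hv2.
unfold euler_numerator.
prove_smooth.
Qed.

Lemma horo_catenary_euler_lagrange (lam a b : R) (u v : R -> R) :
  a < b -> smooth_regular_curve a b u v -> horo_catenary lam a b u v ->
  forall t, a <= t <= b ->
  euler_lagrange lam (u t) (v t) (Derive u t) (Derive v t)
    (Derive_n u 2 t) (Derive_n v 2 t) = 0.
Proof.
intros hab hcurve hcat.
assert (hcurve' := hcurve).
destruct hcurve' as ([du [du_gt0 Hu]] & [dv [dv_gt0 Hv]] & Hplus & Hreg).
assert (d_gt0 : 0 < Rmin du dv) by now apply Rmin_pos.
assert (m1 := Rmin_l du dv); assert (m2 := Rmin_r du dv).
set (d := Rmin du dv) in *.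
assert (Su : smooth_between (a - d) (b + d) u)
  by (apply (smooth_between_weaken _ _ (a - du) (b + du)); auto; lra).
assert (Sv : smooth_between (a - d) (b + d) v)
  by (apply (smooth_between_weaken _ _ (a - dv) (b + dv)); auto; lra).
clear Hu Hv.
assert (Su1 := smooth_between_Derive _ _ _ Su).
assert (Sv1 := smooth_between_Derive _ _ _ Sv).
set (P := euler_numerator lam u v).
assert (SP : smooth_between (a - d) (b + d) P)
  by now apply smooth_between_euler_numerator.
assert (v_gt0 : forall t, a <= t <= b -> 0 < v t) by (intros; now apply Hplus).
assert (m_gt0 : forall t, a <= t <= b -> 0 < speed2 u v t)
  by (intros; now apply speed2_gt0, Hreg).
set (w := fun t => (t + - a) * (b + t * - 1)).
assert (Sw : smooth_between (a - d) (b + d) w).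
{ unfold w; prove_smooth. }
set (xi := fun t => w t * (P t * Derive v t)).
set (eta := fun t => w t * (P t * (- 1 * Derive u t))).
assert (Sxi : smooth_between (a - d) (b + d) xi)
  by (unfold xi; prove_smooth).
assert (Seta : smooth_between (a - d) (b + d) eta)
  by (unfold eta; prove_smooth).
destruct (affine_variation a b d u v xi eta) as [e var];
  auto; try (unfold xi, eta, w; ring); try lra.
(* In this direction [v' xi - u' eta = w P m]; multiplied by [Q / sqrt m = P / (m v^3 sqrt m)] it
   gives [J]. *)
set (J := fun t => w t * P t ^ 2 / (v t ^ 3 * sqrt (speed2 u v t))).
(* The energy has derivative zero at [s = 0] by criticality, and that derivative is also the
   integral of [J] by the first variation formula. *)
assert (J0 : RInt J a b = 0).
{ assert (fv := first_variation_curve lam a b e u v _ _ hab hcurve var).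
  apply is_derive_unique in fv.
  apply (eq_trans (eq_sym (is_derive_unique _ _ _ (hcat _ _ _ var)))),
    eq_sym in fv.
  refine (eq_trans _ fv); apply RInt_ext; rewrite Rmin_left, Rmax_right by lra.
  intros t Ht.
  assert (aff : forall x y, Derive (fun s => x + s * y) 0 = y).
  { intros x y; apply is_derive_unique; auto_derive; [exact I|ring]. }
  rewrite !aff, euler_numeratorE by (try apply v_gt0; try apply m_gt0; lra).
  assert (v1 := v_gt0 t ltac:(lra)); assert (m1' := m_gt0 t ltac:(lra)).
  assert (r1 := sqrt_lt_R0 _ m1').
  unfold J, xi, eta; fold P.
  replace (_ - _) with (w t * P t * speed2 u v t) by (unfold speed2; ring).
  match goal with |- ?l = ?r => change (@eq R l r) end.
  field; lra. }
assert (P0 : forall t, a < t < b -> P t = 0).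
{ intros t Ht.
  assert (v1 := v_gt0 t ltac:(lra)); assert (m1' := m_gt0 t ltac:(lra)).
  assert (r1 := sqrt_lt_R0 _ m1').
  assert (w_gt0 : 0 < w t) by (apply Rmult_lt_0_compat; lra).
  assert (K : J t = 0).
  { apply (RInt_eq0 J a b hab); auto.
    - intros z Hz; unfold J, Rdiv, speed2; simpl pow.
      assert (v1' := v_gt0 z Hz); assert (m2' := m_gt0 z Hz).
      assert (C : forall f, smooth_between (a - d) (b + d) f -> continuous f z)
        by (intros f Hf; apply (smooth_between_continuous (a - d) (b + d));
            auto; lra).
      assert (C1 := C _ Su1); assert (C2 := C _ Sv1); assert (C3 := C _ SP).
      assert (C4 := C _ Sw); assert (C5 := C _ Sv).
      prove_continuous.
      assert (r2 := sqrt_lt_R0 _ m2'); unfold speed2 in r2; simpl pow in r2.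
      apply Rgt_not_eq; repeat apply Rmult_lt_0_compat; lra.
    - intros z Hz.
      assert (v1' := v_gt0 z ltac:(lra)); assert (m2' := m_gt0 z ltac:(lra)).
      apply Rmult_le_pos.
      + apply Rmult_le_pos; [unfold w; apply Rmult_le_pos; lra|apply pow2_ge_0].
      + apply Rlt_le, Rinv_0_lt_compat, Rmult_lt_0_compat;
          [now apply pow_lt|now apply sqrt_lt_R0]. }
  unfold J in K.
  apply Rmult_integral in K as [K|K].
  - apply Rmult_integral in K as [K|K]; [lra|].
    apply Rmult_integral in K as [K|K]; lra.
  - exfalso; revert K; apply Rinv_neq_0_compat, Rgt_not_eq.
    apply Rmult_lt_0_compat; [now apply pow_lt|exact r1]. }
(* The weight [w] vanishes at [a] and [b], so the endpoints are reached by continuity of [P]. *)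
assert (P1 : forall t, a <= t <= b -> P t = 0).
{ apply eq_closed_interval; auto.
  - intros t Ht; apply (smooth_between_continuous (a - d) (b + d)); auto; lra.
  - intros; apply continuous_const. }
intros t Ht; rewrite euler_numeratorE by auto.
fold P; rewrite P1 by auto; apply Rdiv_0_l.
Qed.

Lemma euler_lagrange_horo_catenary (lam a b : R) (u v : R -> R) :
  a < b -> smooth_regular_curve a b u v ->
  (forall t, a <= t <= b ->
   euler_lagrange lam (u t) (v t) (Derive u t) (Derive v t)
    (Derive_n u 2 t) (Derive_n v 2 t) = 0) ->
  horo_catenary lam a b u v.
Proof.
intros hab hcurve EL e U V var.
assert (fv := first_variation_curve lam a b e u v U V hab hcurve var).
rewrite (RInt_ext _ (fun _ => 0)), RInt_const, Rmult_0_r in fv; [exact fv|].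
rewrite Rmin_left, Rmax_right by lra; intros t Ht.
rewrite EL, Rdiv_0_l by lra; apply Rmult_0_l.
Qed.

Theorem corollary3p8 (lam a b : R) (u v : R -> R)
  (hab : a < b)
  (hcurve : smooth_regular_curve a b u v)
  (hlam : forall t : R, a <= t <= b -> d_hor (u t, v t) + lam <> 0) :
  horo_catenary lam a b u v <->
  (forall t : R, a <= t <= b ->
     kappa_h u v t =
     hyp_metric (u t, v t) (unit_normal u v t) (W (u t, v t))
       / (d_hor (u t, v t) + lam)).
Proof.
(* The omitted statement is the pointwise equivalence of the curvature equation with [Q = 0]; both
   directions of the theorem pass through it. *)
assert (H : forall t, a <= t <= b -> _)
  by exact (fun t Ht => curvature_iff_euler_lagrange lam u v t
     (proj2 (proj1 (proj2 (proj2 hcurve)) t Ht))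
     (speed2_gt0 u v t (proj2 (proj2 (proj2 hcurve)) t Ht)) (hlam t Ht)).
split.
- intros hcat t Ht; apply H; auto.
  now apply (horo_catenary_euler_lagrange lam a b).
- intros hk; apply euler_lagrange_horo_catenary; auto.
  intros t Ht; apply H; auto.
Qed.
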